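(* Let $G$ and $H$ be finite graphs, let $v\in V(G)$, and suppose that $G-v$ is a fold of $G$, i.e., there exists $u\in V(G)$, $u\neq v$, with $\mathcal{N}(u)\supseteq\mathcal{N}(v)$; fix such a $u$. Let $i:G-v\hookrightarrow G$ be the inclusion homomorphism and let $f:G\to G-v$ be the folding homomorphism given by $f(v)=u$ and $f(x)=x$ for $x\neq v$. Then: (1) $\mathrm{Bd}\,\mathrm{Hom}(G,H)$ collapses onto $\mathrm{Bd}\,\mathrm{Hom}(G-v,H)$; (2) $\mathrm{Hom}(H,G)$ collapses onto $\mathrm{Hom}(H,G-v)$; (3) the maps $i_H:\mathrm{Hom}(G,H)\to\mathrm{Hom}(G-v,H)$ and $f^H:\mathrm{Hom}(H,G)\to\mathrm{Hom}(H,G-v)$ are strong deformation retractions. Here $\mathrm{Hom}(G-v,H)$ is regarded as a subspace of $\mathrm{Hom}(G,H)$, with $\mathrm{Bd}\,\mathrm{Hom}(G-v,H)$ a subcomplex of $\mathrm{Bd}\,\mathrm{Hom}(G,H)$, by identifying the face poset of $\mathrm{Hom}(G-v,H)$ with the subposet of the face poset of $\mathrm{Hom}(G,H)$ consisting of all $\eta$ with $\eta(v)=\eta(u)$; and $\mathrm{Hom}(H,G-v)$ is regarded as the subcomplex of $\mathrm{Hom}(H,G)$ consisting of all cells $\eta$ with $v\notin\eta(x)$ for all $x\in V(H)$.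
   Context: Graphs are undirected and not necessarily simple: loops are allowed. $V(G)$ denotes the vertex set and $E(G)\subseteq V(G)\times V(G)$ the (symmetric) edge set of a graph $G$. For $v\in V(G)$, $\mathcal{N}(v)=\{x\in V(G)\mid (v,x)\in E(G)\}$ is the set of neighbors of $v$, and $G-v$ is the graph obtained from $G$ by deleting $v$ and all edges adjacent to $v$. A graph homomorphism is a map of vertex sets taking edges to edges. The complex $\mathrm{Hom}(G,H)$: let $\Delta^{V(H)}$ be a simplex with vertex set $V(H)$, and let $C(G,H)=\prod_{x\in V(G)}\Delta^{V(H)}$ (copies of the simplex indexed by the vertices of $G$). $\mathrm{Hom}(G,H)$ is the subcomplex of $C(G,H)$ whose cells are the products $\sigma=\prod_{x\in V(G)}\sigma_x$ of nonempty faces such that for all $x,y\in V(G)$, if $(x,y)\in E(G)$ then $\sigma_x\times\sigma_y\subseteq E(H)$ (faces being identified with their vertex sets). Equivalently, $\mathrm{Hom}(G,H)$ is a polyhedral (regular CW) complex whose cells are indexed by all functions $\eta:V(G)\to 2^{V(H)}\setminus\{\emptyset\}$ such that $(x,y)\in E(G)$ implies $\eta(x)\times\eta(y)\subseteq E(H)$; the closure of the cell $\eta$ consists of all cells $\tilde\eta$ with $\tilde\eta(x)\subseteq\eta(x)$ for all $x\in V(G)$. Thus the face poset of $\mathrm{Hom}(G,H)$ is the set of such $\eta$ ordered by pointwise inclusion. For a regular CW complex $X$, $\mathrm{Bd}\,X$ denotes its barycentric subdivision, i.e., the simplicial complex whose simplices are all (nonempty) chains of the face poset of $X$. Induced maps: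 for a graph homomorphism $\varphi:G\to G'$ and a graph $H$, composition induces continuous maps $\varphi^H:\mathrm{Hom}(H,G)\to\mathrm{Hom}(H,G')$ and $\varphi_H:\mathrm{Hom}(G',H)\to\mathrm{Hom}(G,H)$. On points: $\varphi^H$ applies to each coordinate (indexed by $x\in V(H)$) the affine map $\Delta^{V(G)}\to\Delta^{V(G')}$ extending $\varphi$ on vertices, so that the cell $\eta$ is sent to the cell $x\mapsto\varphi(\eta(x))$; and $\varphi_H$ sends a point $(p_y)_{y\in V(G')}$ to $(p_{\varphi(x)})_{x\in V(G)}$, so that on cells $\eta\mapsto\eta\circ\varphi$. In particular $i_H$ forgets the coordinate indexed by $v$. The identification of $\mathrm{Hom}(G-v,H)$ with a subspace of $\mathrm{Hom}(G,H)$ is the embedding $f_H$. An elementary collapse of a simplicial (more generally, regular CW) complex $X$ is the removal of a pair of cells $(\sigma,\tau)$ of $X$ such that $\sigma$ is a face of $\tau$, $\dim\tau=\dim\sigma+1$, and $\tau$ is the only cell of $X$ having $\sigma$ as a proper face. $X$ collapses onto a subcomplex $Y$ if there is a finite sequence of elementary collapses leading from $X$ to $Y$. A map $r:X\to Y$ onto a subspace $Y\subseteq X$ is a strong deformation retraction if $r|_Y=\mathrm{id}_Y$ and $r$, viewed as a map $X\to X$, is homotopic to $\mathrm{id}_X$ relative to $Y$. *)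

(* Defs.v *)
From HB Require Import structures.
From mathcomp Require Import all_boot all_order all_algebra.

Set Implicit Arguments.
Unset Strict Implicit.
Unset Printing Implicit Defensive.

(** * Finite graphs, loops allowed *)

Record graph := Graph {
  vertex :> finType;
  edge : rel vertex;
  edge_sym : symmetric edge }.

Arguments edge {g} _ _.

Definition neighbors (G : graph) (v : G) : {set G} := [set x | edge v x].

Record graph_hom (G G' : graph) := GraphHom {
  graph_hom_fun :> G -> G';
  graph_hom_edge : forall x y, edge x y -> edge (graph_hom_fun x) (graph_hom_fun y) }.

Section VertexDeletion.
Variables (G : graph) (v : G).

Definition del_edge : rel {x : G | x != v} := fun x y => edge (val x) (val y).

Lemma del_edge_sym : symmetric del_edge.
Proof. by move=> x y; rewrite /del_edge edge_sym. Qed.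

Definition del_vertex : graph := Graph del_edge_sym.

Definition del_incl : graph_hom del_vertex G :=
  @GraphHom del_vertex G val (fun x y => id).

Variables (u : G) (neq_uv : u != v) (sub_vu : neighbors v \subset neighbors u).

Definition fold_fun (x : G) : del_vertex := insubd (Sub u neq_uv) x.

Lemma val_fold_fun x : val (fold_fun x) = if x == v then u else x.
Proof. by rewrite /fold_fun val_insubd; case: eqP. Qed.

Lemma fold_fun_edge x y : edge x y -> edge (fold_fun x) (fold_fun y).
Proof.
have step (z : G) : edge v z -> edge u z.
  by move=> evz; have := subsetP sub_vu z; rewrite !inE; exact.
rewrite [edge (fold_fun x) _]/= /del_edge !val_fold_fun.
case: (eqVneq x v) => [->|nxv]; case: (eqVneq y v) => [->|nyv] //.
- by move=> /step; rewrite edge_sym => /step.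
- exact: step.
- by rewrite edge_sym => /step; rewrite edge_sym.
Qed.

Definition fold_hom : graph_hom G del_vertex := GraphHom fold_fun_edge.

End VertexDeletion.

(** * Collapses and barycentric subdivision

A finite regular CW complex enters through its set of (nonempty) cells, a
finite set [X] in an ambient type [C] of cells, with the relation
[face s t] (s is a face of t, possibly s = t) and the dimension function. *)

Section Complexes.
Variables (C : finType) (face : rel C) (dim : C -> nat).

(* [t] is then a maximal cell of [X], so that [Y] is a subcomplex whenever [X]
   is a complex. *)
Definition elementary_collapse : rel {set C} := fun X Y =>
  [exists s, exists t,
    [&& s \in X, t \in X, face s t, dim t == (dim s).+1,
        [forall r in X, (face s r && (r != s)) ==> (r == t)]
      & Y == X :\: [set s; t]]].

Definition collapses_onto (X Y : {set C}) : Prop :=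
  connect elementary_collapse X Y.

Definition barycentric_subdivision (X : {set C}) : {set {set C}} :=
  [set c : {set C} | [&& c != set0, c \subset X
    & [forall s in c, forall t in c, face s t || face t s]]].

End Complexes.

Definition simplicial_collapses_onto (T : finType) (X Y : {set {set T}}) : Prop :=
  collapses_onto (fun s t : {set T} => s \subset t) (fun s => #|s|.-1) X Y.

(** * The cells of Hom(G, H) *)

Section HomCells.
Variables G H : graph.

Definition hom_cells : {set {ffun G -> {set H}}} :=
  [set eta : {ffun G -> {set H}} | [forall x, eta x != set0] &&
    [forall x, forall y, edge x y ==>
      [forall a in eta x, forall b in eta y, edge a b]]].

Definition hom_face : rel {ffun G -> {set H}} :=
  fun eta theta => [forall x, eta x \subset theta x].

Definition hom_dim (eta : {ffun G -> {set H}}) : nat :=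
  (\sum_x #|eta x|.-1)%N.

Lemma hom_cellsP (eta : {ffun G -> {set H}}) :
  reflect ((forall x, eta x != set0) /\
           (forall x y, edge x y ->
              forall a b, a \in eta x -> b \in eta y -> edge a b))
          (eta \in hom_cells).
Proof.
rewrite inE; apply: (iffP andP) => -[n0 h]; split.
- exact/forallP.
- move=> x y exy a b ax bY.
  move/forallP/(_ x)/forallP/(_ y)/implyP/(_ exy) : h.
  by move/forall_inP/(_ a ax)/forall_inP/(_ b bY).
- exact/forallP.
- apply/forallP => x; apply/forallP => y; apply/implyP => exy.
  by apply/forall_inP => a ax; apply/forall_inP => b bY; exact: h exy _ _ ax bY.
Qed.

End HomCells.

Section InducedOnCells.
Variables (G G' : graph) (phi : graph_hom G G') (H : graph).

(* the action of phi^H and of phi_H on cells *)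
Definition cell_push (eta : {ffun H -> {set G}}) : {ffun H -> {set G'}} :=
  [ffun x => [set phi a | a in eta x]].

Definition cell_pull (eta : {ffun G' -> {set H}}) : {ffun G -> {set H}} :=
  [ffun x => eta (phi x)].

Lemma cell_push_hom eta : eta \in hom_cells H G -> cell_push eta \in hom_cells H G'.
Proof.
move=> /hom_cellsP[n0 h]; apply/hom_cellsP; split=> [x|x y exy a' b'].
  by rewrite ffunE imset_eq0.
rewrite !ffunE => /imsetP[a ax ->] /imsetP[b bY ->].
by apply: graph_hom_edge; apply: h exy _ _ ax bY.
Qed.

Lemma cell_pull_hom eta : eta \in hom_cells G' H -> cell_pull eta \in hom_cells G H.
Proof.
move=> /hom_cellsP[n0 h]; apply/hom_cellsP; split=> [x|x y exy a b].
  by rewrite ffunE.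
by rewrite !ffunE; apply: h; exact: graph_hom_edge.
Qed.

End InducedOnCells.

Section FoldCells.
Variables (G H : graph) (u v : G) (neq_uv : u != v).
Variable sub_vu : neighbors v \subset neighbors u.
Let f := fold_hom neq_uv sub_vu.
Let i := del_incl v.

Lemma fold_incl x : f (i x) = x.
Proof. by apply: val_inj; rewrite /= val_fold_fun (negPf (valP x)). Qed.

Lemma cell_pull_fold_image :
  (cell_pull f (H := H) @: hom_cells (del_vertex v) H =
   [set eta in hom_cells G H | eta v == eta u]).
Proof.
apply/setP => eta; rewrite [RHS]inE; apply/imsetP/andP.
  move=> [theta ht ->]; split; first exact: cell_pull_hom.
  rewrite !ffunE; apply/eqP; congr (theta _); apply: val_inj.
  by rewrite /= !val_fold_fun eqxx (negPf neq_uv).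
move=> [he /eqP evu]; exists (cell_pull i eta); first exact: cell_pull_hom.
apply/ffunP => x; rewrite !ffunE /= val_fold_fun.
by case: eqP => [->|].
Qed.

Lemma cell_pull_fold_face :
  {mono cell_pull f (H := H) : eta theta / hom_face eta theta}.
Proof.
move=> eta theta; apply/forallP/forallP => h x.
  by have := h (i x); rewrite !ffunE fold_incl.
by rewrite !ffunE.
Qed.

Lemma cell_push_incl_image :
  (cell_push i (H := H) @: hom_cells H (del_vertex v) =
   [set eta in hom_cells H G | [forall x, v \notin eta x]]).
Proof.
apply/setP => eta; rewrite [RHS]inE; apply/imsetP/andP.
  move=> [theta ht ->]; split; first exact: cell_push_hom.
  apply/forallP => x; rewrite ffunE; apply/imsetP => -[a _ va].
  by have := valP a; rewrite /= -[val a]va eqxx.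
move=> [he /forallP nv]; exists (cell_push f eta); first exact: cell_push_hom.
apply/ffunP => x; rewrite !ffunE -imset_comp -[LHS]imset_id.
apply: eq_in_imset => a ax /=; rewrite val_fold_fun.
by case: eqP => // av; move: (nv x); rewrite -av ax.
Qed.

Lemma cell_push_incl_face :
  {mono cell_push i (H := H) : eta theta / hom_face eta theta}.
Proof.
move=> eta theta; apply: eq_forallb => x; rewrite !ffunE.
apply/idP/idP; last exact: imsetS.
move=> /subsetP h; apply/subsetP => a ax.
by have /imsetP[b bt /val_inj->] := h _ (imset_f i ax).
Qed.

End FoldCells.

(** * The space Hom(G, H) *)

(* Imported only here: [classical_sets] shadows the names of [finset]. *)
From mathcomp Require Import all_classical all_reals all_analysis.
Import Order.TTheory GRing.Theory Num.Theory.
Import numFieldNormedType.Exports.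


Local Open Scope classical_set_scope.
Local Open Scope ring_scope.

Section HomSpace.
Variable R : realType.

(* the face of the simplex Delta^T with vertex set s, in barycentric
   coordinates *)
Definition simplex_face (T : finType) (s : {set T}) : set {ptws T -> R} :=
  [set p | [/\ forall a, 0 <= p a, \sum_a p a = 1
             & forall a, a \notin s -> p a = 0]].

Definition closed_cell (G H : graph) (eta : {ffun G -> {set H}}) :
    set {ptws G -> {ptws H -> R}} :=
  [set p | forall x, simplex_face (eta x) (p x)].

Definition hom_points (G H : graph) : set {ptws G -> {ptws H -> R}} :=
  \bigcup_(eta in [set` hom_cells G H]) closed_cell eta.

Arguments hom_points : clear implicits.

(* the subtype of points, with the subspace topology *)
Definition hom_space (G H : graph) : topologicalType :=
  set_type (hom_points G H).

Section InducedMaps.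
Variables (G G' : graph) (phi : graph_hom G G') (H : graph).

(* the affine extension Delta^V(G) -> Delta^V(G') of phi *)
Definition affine_ext (p : {ptws G -> R}) : {ptws G' -> R} :=
  fun b => \sum_(a | phi a == b) p a.

Definition push_points (p : {ptws H -> {ptws G -> R}}) :
    {ptws H -> {ptws G' -> R}} := fun x => affine_ext (p x).

Definition pull_points (p : {ptws G' -> {ptws H -> R}}) :
    {ptws G -> {ptws H -> R}} := fun x => p (phi x).

Lemma push_points_cell eta :
  closed_cell eta `<=` push_points @^-1` closed_cell (cell_push phi eta).
Proof.
move=> p hp x; have [p0 p1 ps] := hp x; split=> [b||b].
- exact: sumr_ge0.
- rewrite -p1 (partition_big phi predT)//=.
- rewrite ffunE => bN; rewrite /push_points /affine_ext big1// => a /eqP ab.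
  by apply: ps; apply: contra bN => ax; rewrite -ab; exact: imset_f.
Qed.

Lemma pull_points_cell eta :
  closed_cell eta `<=` pull_points @^-1` closed_cell (cell_pull phi eta).
Proof. by move=> p hp x; rewrite ffunE; exact: hp. Qed.

Lemma push_points_hom (p : hom_space H G) :
  push_points (\val p) \in hom_points H G'.
Proof.
apply/mem_set; case: p => p /= /set_mem[eta he hp].
exists (cell_push phi eta); first exact: cell_push_hom.
exact: push_points_cell hp.
Qed.

Lemma pull_points_hom (p : hom_space G' H) :
  pull_points (\val p) \in hom_points G H.
Proof.
apply/mem_set; case: p => p /= /set_mem[eta he hp].
exists (cell_pull phi eta); first exact: cell_pull_hom.
exact: pull_points_cell hp.
Qed.

(* phi^H *)
Definition hom_push (p : hom_space H G) : hom_space H G' :=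
  exist _ (push_points (\val p)) (push_points_hom p).

(* phi_H *)
Definition hom_pull (p : hom_space G' H) : hom_space G H :=
  exist _ (pull_points (\val p)) (pull_points_hom p).

End InducedMaps.

(** * Strong deformation retractions *)

Definition homotopic_rel (X Y : topologicalType) (A : set X) (f g : X -> Y) : Prop :=
  exists F : R * X -> Y,
    [/\ {within `[0, 1] `*` [set: X], continuous F},
        forall x, F (0, x) = f x,
        forall x, F (1, x) = g x
      & forall t x, 0 <= t <= 1 -> A x -> F (t, x) = f x].

(* [Y] is regarded as a subspace of [X] through [e], which is an embedding
   because [r] restricts to a continuous inverse of [e] on its image. *)
Definition strong_deformation_retraction (X Y : topologicalType)
    (e : Y -> X) (r : X -> Y) : Prop :=
  [/\ continuous e, continuous r, cancel e r
    & homotopic_rel (range e) (e \o r) idfun].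

End HomSpace.

Arguments hom_push R {G G'} phi H p.
Arguments hom_pull R {G G'} phi H p.
Arguments cell_push {G G'} phi H eta.
Arguments cell_pull {G G'} phi H eta.

(* Main.v *)
(**
Call [f] the fold.  On cells of Hom(G, H), replacing eta(v) by
eta(u) \cup eta(v) is an ascending closure operator; on its fixed cells,
replacing eta(v) by eta(u) is a descending one, whose fixed cells form
Hom(G - v, H).  The order complex of a poset collapses onto that of the fixed
points of a closure operator phi: a maximal non-fixed x has phi(x) as least
element above it, so its link is a cone.

For Hom(H, G), the vertices x of H are treated one at a time: the cells with
v in eta(x) are removed in pairs that differ by u in eta(x).

For any point p, the segment from p to its image under the retraction lies in
one closed cell, so the straight-line homotopy stays inside the complex.
*)
Require Import Defs.
From mathcomp Require Import all_boot all_order all_algebra.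

Set Implicit Arguments.
Unset Strict Implicit.
Unset Printing Implicit Defensive.

(** * Collapses along a matching of cells *)

Section CollapseMatching.
Variables (C : finType) (face : rel C) (dim : C -> nat).

(* A face-maximal [s] in [S] is a free face of [m s], so pairs can be removed
   one by one. *)
Lemma collapses_onto_matching (m : C -> C) (X S : {set C}) :
    S \subset X ->
    {in S, forall s, m s \in X :\: S} -> {in S &, injective m} ->
    {in S, forall s, face s (m s) /\ dim (m s) = (dim s).+1} ->
    {in S &, forall s t, face s t -> s = t \/ dim s < dim t} ->
    {in S & X, forall s r, face s r -> r \in S :|: m @: S} ->
    {in S &, forall s t, face s (m t) -> face s t} ->
  collapses_onto face dim X (X :\: (S :|: m @: S)).
Proof.
move: {2}#|S| (leqnn #|S|) => n.
elim: n X S => [|n IHn] X S.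
  rewrite leqn0 cards_eq0 => /eqP-> *.
  by rewrite imset0 setU0 setD0; exact: connect0.
have [->|[s0 s0S]] := set_0Vmem S.
  by rewrite imset0 setU0 setD0 => *; exact: connect0.
move=> leSn SX mX minj mface dimS up mdown.
(* Proper faces within [S] strictly raise the dimension, so no other cell of [S] lies above an [s]
   of largest dimension. *)
have [s sS' smax] := arg_maxnP dim s0S.
have sS : s \in S := sS'.
have maxs t : t \in S -> face s t -> t = s.
  move=> tS st; have [//|] := dimS s t sS tS st.
  by rewrite ltnNge => /negP[]; exact: smax.
have sX : s \in X by exact: (subsetP SX).
have /setDP[msX msS] := mX s sS.
have [fms dms] := mface s sS.
pose X' := X :\: [set s; m s].
have step : elementary_collapse face dim X X'.
  apply/existsP; exists s; apply/existsP; exists (m s).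
  rewrite sX msX fms dms !eqxx /= andbT; apply/forall_inP => r rX.
  (* A coface of [s] in [S] is [s] itself. A coface [m t] puts [s] below [t] by the last hypothesis,
     hence [t = s]; so [m s] is the only proper coface. *)
  apply/implyP => /andP[fsr nrs]; have := up s r sS rX fsr.
  rewrite inE => /orP[rS|/imsetP[t tS rt]].
    by rewrite (maxs r rS fsr) eqxx in nrs.
  by rewrite rt (maxs t tS) //; apply: mdown => //; rewrite -rt.
pose S' := S :\ s.
have S'S t : t \in S' -> t \in S by case/setD1P.
have -> : X :\: (S :|: m @: S) = X' :\: (S' :|: m @: S').
  have -> : m @: S = m s |: m @: S' by rewrite -imsetU1 setD1K.
  rewrite -{1}(setD1K sS) -/S'; apply/setP => r; rewrite !inE.
  by case: (r == s); case: (r == m s); case: (_ \in X); rewrite ?andbF ?orbT ?orbF.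
apply: connect_trans (connect1 step) _; apply: IHn.
- by have := leSn; rewrite (cardsD1 s S) sS.
- apply/subsetP => t /setD1P[nts tS]; rewrite !inE (negPf nts) (subsetP SX) //.
  by rewrite andbT; apply: contraNneq msS => <-.
- move=> t /setD1P[nts tS]; have /setDP[mtX mtS] := mX t tS.
  rewrite !inE mtX (negPf mtS) !andbF !andbT /= negb_or.
  apply/andP; split; first by apply: contraNneq mtS => ->.
  by apply: contra_neq nts; exact: minj.
- by move=> t t' /S'S tS /S'S; exact: minj.
- by move=> t /S'S; exact: mface.
- by move=> t t' /S'S tS /S'S; exact: dimS.
- move=> t r /S'S tS /setDP[rX]; rewrite !inE negb_or => /andP[nrs nrms] ftr.
  have := up t r tS rX ftr; rewrite !inE nrs /= => /orP[->//|/imsetP[t' t'S rt]].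
  apply/orP; right; apply/imsetP; exists t' => //; apply/setD1P; split=> //.
  by apply: contra_neq nrms => <-.
- by move=> t t' /S'S tS /S'S; exact: mdown.
Qed.

End CollapseMatching.

(** * Collapses of order complexes *)

Section BarycentricCollapse.
Variables (T : finType) (face : rel T).
Local Notation bd := (barycentric_subdivision face).

Lemma barycentric_subdivisionP (X c : {set T}) :
  reflect [/\ c != set0, c \subset X
            & {in c &, forall s t, face s t || face t s}]
          (c \in bd X).
Proof.
rewrite inE; apply: (iffP and3P) => -[c0 cX h]; split=> //.
  by move=> s t sc tc; move/forall_inP/(_ s sc)/forall_inP/(_ t tc): h.
by apply/forall_inP => s sc; apply/forall_inP => t tc; exact: h.
Qed.

(* Chains through [x] are matched by adding or deleting [w]. *)
Lemma barycentric_subdivision_collapse_point (X : {set T}) (x w : T) :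
    x \in X -> w \in X -> x != w -> reflexive face ->
    {in X, forall y, face x y || face y x -> face w y || face y w} ->
  simplicial_collapses_onto (bd X) (bd (X :\ x)).
Proof.
move=> xX wX nxw face_refl dom.
pose S := [set c in bd X | (x \in c) && (w \notin c)].
(* Members of a chain through [x] are comparable with [x], hence with [w], so adding [w] keeps a
   chain. *)
have addw c : c \in bd X -> x \in c -> w |: c \in bd X.
  move=> /barycentric_subdivisionP[c0 cX ch] xc.
  have wch s : s \in c -> face w s || face s w.
    by move=> sc; apply: dom; [exact: (subsetP cX)|exact: ch].
  apply/barycentric_subdivisionP; split.
  - by apply/set0Pn; exists w; exact: setU11.
  - by rewrite subUset sub1set wX.
  - move=> s t /setU1P[->|sc] /setU1P[->|tc]; rewrite ?face_refl //; first exact: wch.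
      by rewrite orbC wch.
    exact: ch.
have subbd c d : d \in bd X -> c != set0 -> c \subset d -> c \in bd X.
  move=> /barycentric_subdivisionP[d0 dX ch] c0 cd.
  apply/barycentric_subdivisionP; split=> //; first exact: subset_trans dX.
  by move=> s t /(subsetP cd) sd /(subsetP cd); exact: ch.
(* The matched pairs exhaust the chains through [x]: deleting [w] from such a chain leaves [x] in
   it, since [x != w]. *)
have SE : S :|: (fun c => w |: c) @: S = [set c in bd X | x \in c].
  apply/setP => c; rewrite in_setU [in RHS]in_set [X in X || _]in_set.
  apply/orP/andP => [[/and3P[]//|/imsetP[d]]|[cX xc]].
    rewrite in_set => /and3P[dX xd _] ->.
    by rewrite addw // in_setU1 xd orbT.
  have [wc|wc] := boolP (w \in c); last by left; rewrite cX xc.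
  right; apply/imsetP; exists (c :\ w); last by rewrite setD1K.
  rewrite in_set !in_setD1 eqxx nxw xc /= andbT; apply: subbd cX _ (subsetDl _ _).
  by apply/set0Pn; exists x; rewrite !inE nxw.
have -> : bd (X :\ x) = bd X :\: (S :|: (fun c => w |: c) @: S).
  rewrite SE; apply/setP => c; rewrite in_setD !in_set subsetD1.
  by case: (x \in c); rewrite ?andbT ?andbF ?andNb ?andbF.
apply: collapses_onto_matching.
- by apply/subsetP => c; rewrite inE => /andP[].
- move=> c; rewrite inE => /and3P[cX xc wc]; rewrite in_setD addw // andbT.
  by rewrite inE setU11 /= !andbF.
- move=> c d; rewrite !in_set => /and3P[_ _ wc] /and3P[_ _ wd] e.
  by rewrite -(setU1K wc) e setU1K.
- move=> c; rewrite in_set => /and3P[cX xc wc]; split; first exact: subsetUr.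
  by rewrite cardsU1 wc /= prednK //; apply/card_gt0P; exists x.
- move=> c d; rewrite !in_set => /and3P[_ xc wc] /and3P[_ xd wd] cd.
  have [->|ncd] := eqVneq c d; [by left|right].
  have : #|c| < #|d| by rewrite proper_card // properEneq ncd.
  have : 0 < #|c| by apply/card_gt0P; exists x.
  by case: #|c| => // a _; case: #|d|.
- move=> c d; rewrite in_set => /and3P[_ xc _] dX cd.
  by rewrite SE in_set dX (subsetP cd).
- move=> c d; rewrite !in_set => /and3P[_ xc wc] _ cd.
  apply/subsetP => y yc; have := subsetP cd y yc.
  by rewrite in_setU1 => /predU1P[yw|//]; rewrite -yw yc in wc.
Qed.

(** Chains do not see the direction of the order; this lets a result on ascending operators serve
    descending ones. *)
Lemma barycentric_subdivision_converse (X : {set T}) :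
  barycentric_subdivision (fun s t => face t s) X = bd X.
Proof.
apply/setP => c; rewrite !inE; congr [&& _, _ & _].
by apply: eq_forallb => s; congr (_ ==> _); apply: eq_forallb => t; rewrite orbC.
Qed.

End BarycentricCollapse.

(* A maximal non-fixed [x] is dominated by [phi x], the least element of [X]
   above it, and so can be removed. *)
Lemma barycentric_subdivision_collapse_closure (T : finType) (face : rel T)
    (phi : T -> T) (X : {set T}) :
    reflexive face -> antisymmetric face -> transitive face ->
    {in X, forall x, phi x \in X} -> {in X, forall x, face x (phi x)} ->
    {in X &, {homo phi : x y / face x y}} -> {in X, forall x, phi (phi x) = phi x} ->
  simplicial_collapses_onto (barycentric_subdivision face X)
    (barycentric_subdivision face [set x in X | phi x == x]).
Proof.
move=> refl anti trans.
move: {2}#|X| (leqnn #|X|) => n; elim: n X => [|n IHn] X.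
  rewrite leqn0 cards_eq0 => /eqP-> *.
  have -> : [set x in set0 | phi x == x] = set0 by apply/setP => x; rewrite !inE.
  exact: connect0.
move=> Xn phiX phi_ge phi_homo phiK.
pose F := [set x in X | phi x != x].
have [/eqP F0|[x0 x0F]] := set_0Vmem F.
  suff -> : [set x in X | phi x == x] = X by exact: connect0.
  apply/setP => x; rewrite inE andb_idr // => xX.
  by apply: contraTT F0 => nx; apply/set0Pn; exists x; apply/setIdP.
(* The size of the down-set grows strictly along the order, so maximizing it over [F] yields a
   maximal non-fixed point. *)
pose height x := #|[set y | face y x]|.
have [x xF xmax] := arg_maxnP height x0F.
have /setIdP[xX nx] : x \in F := xF.
have fixed_above y : y \in X -> face x y -> y != x -> phi y = y.
  move=> yX fxy nyx; apply/eqP; apply: contraTT isT => ny.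
  have : height y <= height x by apply: xmax; apply/setIdP.
  rewrite leqNgt => /negP[]; apply: proper_card; apply/properP; split.
    by apply/subsetP => z; rewrite !inE => /trans; exact.
  exists y; rewrite !inE ?refl //; apply: contra nyx => fyx.
  by apply/eqP/anti; rewrite fyx fxy.
have collx : simplicial_collapses_onto (barycentric_subdivision face X)
    (barycentric_subdivision face (X :\ x)).
  apply: (barycentric_subdivision_collapse_point (w := phi x)) => //.
  - exact: phiX.
  - by rewrite eq_sym.
  (* A proper upper bound [y] of [x] is fixed, so monotonicity puts [phi x] below [phi y = y]; a
     lower bound of [x] is below [phi x] by transitivity. *)
  - move=> y yX /orP[fxy|fyx].
      have [->|nyx] := eqVneq y x; first by rewrite phi_ge ?orbT.
      by rewrite -(fixed_above y) // phi_homo.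
    by rewrite (trans _ _ _ fyx (phi_ge x xX)) orbT.
apply: connect_trans collx _.
have -> : [set x in X | phi x == x] = [set z in X :\ x | phi z == z].
  apply/setP => z; rewrite !inE; have [->|//] := eqVneq z x.
  by rewrite (negPf nx) andbF.
have X'X z : z \in X :\ x -> z \in X by case/setD1P.
apply: IHn.
- by have := Xn; rewrite (cardsD1 x X) xX.
(* [phi y] is fixed and [x] is not, so [phi] still maps the smaller set into itself. *)
- move=> y /setD1P[nyx yX]; rewrite !inE phiX // andbT.
  by apply: contra nx => /eqP <-; rewrite phiK.
- by move=> y /X'X; exact: phi_ge.
- by move=> y z /X'X yX /X'X; exact: phi_homo.
- by move=> y /X'X; exact: phiK.
Qed.

(** * The face order on cells of Hom *)

Section HomFace.
Variables G H : graph.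

Lemma hom_faceP (eta theta : {ffun G -> {set H}}) :
  reflect (forall x, eta x \subset theta x) (hom_face eta theta).
Proof. exact: forallP. Qed.

Lemma hom_face_refl : reflexive (@hom_face G H).
Proof. by move=> eta; apply/hom_faceP => x. Qed.

Lemma hom_face_trans : transitive (@hom_face G H).
Proof.
move=> theta eta zeta /hom_faceP h1 /hom_faceP h2; apply/hom_faceP => x.
exact: subset_trans (h1 x) (h2 x).
Qed.

Lemma hom_face_anti : antisymmetric (@hom_face G H).
Proof.
move=> eta theta /andP[/hom_faceP h1 /hom_faceP h2]; apply/ffunP => x.
by apply/eqP; rewrite eqEsubset h1 h2.
Qed.

End HomFace.

(** * Collapse of Bd Hom(G, H) along a fold *)

Section FoldCollapses.
Variables (G H : graph) (u v : G).
Hypotheses (neq_uv : u != v) (sub_vu : neighbors v \subset neighbors u).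

Lemma fold_edge a : edge v a -> edge u a.
Proof. by move=> eva; have := subsetP sub_vu a; rewrite !inE; exact. Qed.

Lemma fold_loop : edge v v -> edge u u.
Proof. by move=> /fold_edge; rewrite edge_sym => /fold_edge. Qed.

Definition cell_join (eta : {ffun G -> {set H}}) : {ffun G -> {set H}} :=
  [ffun x => if x == v then eta u :|: eta v else eta x].

(** Every edge at [v] remains an edge when [v] is replaced by [u], so elements of [eta u] obey all
    constraints at [v]. A loop at [v] also yields a loop at [u], which covers pairs taken inside
    [eta u]. *)
Lemma cell_join_hom eta : eta \in hom_cells G H -> cell_join eta \in hom_cells G H.
Proof.
move=> /hom_cellsP[n0 h]; apply/hom_cellsP; split=> [x|x y exy a b].
  by rewrite ffunE; case: ifP => // _; rewrite setU_eq0 negb_and n0.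
have euy : x = v -> edge u y by move=> xv; apply: fold_edge; rewrite -xv.
have exu : y = v -> edge x u.
  by move=> yv; rewrite edge_sym; apply: fold_edge; rewrite -yv edge_sym.
have euu : x = v -> y = v -> edge u u.
  by move=> xv yv; apply: fold_loop; rewrite -[X in edge X _]xv -yv.
rewrite !ffunE; case: eqP => [xv|_]; case: eqP => [yv|_]; last exact: h.
- by subst x y => /setUP[]ha /setUP[]hb; apply: (h _ _ _ a b ha hb); auto.
- by rewrite -xv => /setUP[]ha hb; apply: (h _ _ _ a b ha hb); auto.
- by rewrite -yv => ha /setUP[]hb; apply: (h _ _ _ a b ha hb); auto.
Qed.

Definition cell_copy (eta : {ffun G -> {set H}}) : {ffun G -> {set H}} :=
  [ffun x => if x == v then eta u else eta x].

(** Copying is pulling back along the inclusion and then along the fold, and both pullbacks preserve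
    cells. *)
Lemma cell_copy_hom eta : eta \in hom_cells G H -> cell_copy eta \in hom_cells G H.
Proof.
move=> he; suff -> : cell_copy eta =
    cell_pull (fold_hom neq_uv sub_vu) H (cell_pull (del_incl v) H eta).
  by do 2!apply: cell_pull_hom.
by apply/ffunP => x; rewrite !ffunE /= val_fold_fun; case: eqP.
Qed.

Lemma collapse_hom_pull :
  simplicial_collapses_onto
    (barycentric_subdivision (@hom_face G H) (hom_cells G H))
    (barycentric_subdivision (@hom_face G H)
       (cell_pull (fold_hom neq_uv sub_vu) H @: hom_cells (del_vertex v) H)).
Proof.
rewrite cell_pull_fold_image.
(* Joining comes first because on [mid] the set [eta u] lies inside [eta v], which makes copying
   descending; on arbitrary cells the two sets need not be comparable. *)
pose mid := [set eta in hom_cells G H | cell_join eta == eta].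
have midE eta : (cell_join eta == eta) = (eta u \subset eta v).
  apply/eqP/idP => [<-|uv].
    by rewrite !ffunE eqxx (negPf neq_uv) subsetUl.
  by apply/ffunP => x; rewrite ffunE; case: eqP => // ->; exact/setUidPr.
have in_mid eta : (eta \in mid) = (eta \in hom_cells G H) && (eta u \subset eta v).
  by rewrite [LHS]in_set midE.
apply: (@connect_trans _ _ (barycentric_subdivision (@hom_face G H) mid)).
  apply: barycentric_subdivision_collapse_closure.
  - exact: hom_face_refl.
  - exact: hom_face_anti.
  - exact: hom_face_trans.
  - exact: cell_join_hom.
  - by move=> eta _; apply/hom_faceP => x; rewrite ffunE; case: eqP => // ->; exact: subsetUr.
  - move=> eta theta _ _ /hom_faceP h; apply/hom_faceP => x; rewrite !ffunE.
    by case: eqP => // _; exact: setUSS.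
  - by move=> eta _; apply/eqP; rewrite midE !ffunE eqxx (negPf neq_uv) subsetUl.
have -> : [set eta in hom_cells G H | eta v == eta u] =
          [set eta in mid | cell_copy eta == eta].
  apply/setP => eta; rewrite [in LHS]in_set [in RHS]in_set in_mid -andbA.
  congr (_ && _); apply/eqP/andP => [e|[_ /eqP <-]].
    split; first by rewrite e.
    by apply/eqP/ffunP => x; rewrite ffunE; case: eqP => // ->.
  by rewrite !ffunE eqxx (negPf neq_uv).
(* Reversing the order turns [cell_copy] into an ascending operator. *)
rewrite -!(barycentric_subdivision_converse (@hom_face G H)).
apply: barycentric_subdivision_collapse_closure.
- exact: hom_face_refl.
- by move=> eta theta /andP[h1 h2]; apply: hom_face_anti; rewrite h1 h2.
- by move=> theta eta zeta h1 h2; exact: hom_face_trans h2 h1.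
- move=> eta; rewrite !in_mid => /andP[he uv].
  by rewrite cell_copy_hom // !ffunE eqxx (negPf neq_uv) /=.
- move=> eta; rewrite in_mid => /andP[_ uv]; apply/hom_faceP => x.
  by rewrite ffunE; case: eqP => // ->.
- move=> eta theta _ _ /hom_faceP h; apply/hom_faceP => x; rewrite !ffunE.
  by case: eqP => // _.
- by move=> eta _; apply/ffunP => x; rewrite !ffunE (negPf neq_uv); case: eqP.
Qed.

(** * Collapse of Hom(H, G), one vertex of H at a time *)

Definition cell_add (A : {set H}) (eta : {ffun H -> {set G}}) : {ffun H -> {set G}} :=
  [ffun x => if (x \in A) && (v \in eta x) then u |: eta x else eta x].

(** Where [v] is an allowed value, [u] inherits all its adjacencies. A singleton [A] gives the
    matching used for collapsing; the full vertex set gives the cell carrying the homotopy. *)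
Lemma cell_add_hom A eta : eta \in hom_cells H G -> cell_add A eta \in hom_cells H G.
Proof.
move=> /hom_cellsP[n0 h]; apply/hom_cellsP; split=> [x|x y exy a b].
  by rewrite ffunE; case: ifP => // _; apply/set0Pn; exists u; exact: setU11.
rewrite !ffunE; case: ifP => [/andP[_ vx]|_]; case: ifP => [/andP[_ vy]|_].
- move=> /setU1P[->|ax] /setU1P[->|bY].
  + by apply: fold_loop; exact: h exy _ _ vx vy.
  + by apply: fold_edge; exact: h exy _ _ vx bY.
  + by rewrite edge_sym; apply: fold_edge; rewrite edge_sym; exact: h exy _ _ ax vy.
  + exact: h exy _ _ ax bY.
- move=> /setU1P[->|ax] bY; last exact: h exy _ _ ax bY.
  by apply: fold_edge; exact: h exy _ _ vx bY.
- move=> ax /setU1P[->|bY]; last exact: h exy _ _ ax bY.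
  by rewrite edge_sym; apply: fold_edge; rewrite edge_sym; exact: h exy _ _ ax vy.
- exact: h exy a b.
Qed.

(** The family interpolates between Hom(H, G), for [A] empty, and Hom(H, G - v), for [A] the full
    vertex set. *)
Definition cells_avoiding (A : {set H}) : {set {ffun H -> {set G}}} :=
  [set eta in hom_cells H G | [forall x in A, v \notin eta x]].

Lemma in_cells_avoiding A eta :
  (eta \in cells_avoiding A) =
  (eta \in hom_cells H G) && [forall x in A, v \notin eta x].
Proof. by rewrite [LHS]in_set. Qed.

(** If the cells differ, some coordinate grows strictly and none shrinks. Nonempty values give
    strictness, as the truncated predecessor assigns 0 to an empty set and to a singleton alike. *)
Lemma hom_dim_lt (eta theta : {ffun H -> {set G}}) :
    (forall x, eta x != set0) -> hom_face eta theta ->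
  eta = theta \/ hom_dim eta < hom_dim theta.
Proof.
move=> n0 /hom_faceP le; have [->|neq] := eqVneq eta theta; [by left|right].
have le1 x : #|eta x|.-1 <= #|theta x|.-1.
  by rewrite -!subn1 leq_sub2r // subset_leq_card.
have [x nx] : exists x, eta x != theta x.
  apply/existsP; apply: contraNT neq; rewrite negb_exists => /forallP h.
  by apply/eqP/ffunP => x; apply/eqP; have := h x; rewrite negbK.
rewrite /hom_dim (bigD1 x) //= [X in _ < X](bigD1 x) //= -addSn leq_add //; last first.
  by apply: leq_sum => y _.
have : #|eta x| < #|theta x| by rewrite proper_card // properEneq nx le.
have : 0 < #|eta x| by rewrite card_gt0.
by case: #|eta x| => // a _; case: #|theta x|.
Qed.

(* Cells [eta] with [v \in eta x] are matched by adding [u] to [eta x] or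
   deleting it. *)
Lemma cells_avoiding_collapse (A : {set H}) (x : H) :
  collapses_onto (@hom_face H G) (@hom_dim H G)
    (cells_avoiding A) (cells_avoiding (x |: A)).
Proof.
pose S := [set eta in cells_avoiding A | (v \in eta x) && (u \notin eta x)].
pose m := cell_add [set x].
have mx (eta : {ffun H -> {set G}}) : v \in eta x -> m eta x = u |: eta x.
  by move=> vx; rewrite ffunE in_set1 eqxx vx.
have my (eta : {ffun H -> {set G}}) y : y != x -> m eta y = eta y.
  by move=> nyx; rewrite ffunE in_set1 (negPf nyx).
have mXS eta : eta \in cells_avoiding A -> m eta \in cells_avoiding A.
  rewrite !in_cells_avoiding => /andP[he /forall_inP av].
  rewrite cell_add_hom //=; apply/forall_inP => y yA; rewrite ffunE; case: ifP; last by rewrite av.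
  by rewrite (negPf (av y yA)) andbF.
have SE : S :|: m @: S = [set eta in cells_avoiding A | v \in eta x].
  apply/setP => eta; rewrite in_setU [in RHS]in_set [X in X || _]in_set.
  apply/orP/andP => [[/and3P[-> ->]//|/imsetP[theta]]|[hA vx]].
    rewrite in_set => /and3P[hA vx ux] ->; rewrite mXS // mx //.
    by rewrite in_setU1 vx orbT.
  have [ux|ux] := boolP (u \in eta x); last by left; rewrite hA vx.
  (* The partner drops [u] at [x]; its value there stays nonempty because [v] remains. *)
  right; pose theta : {ffun H -> {set G}} :=
    [ffun y => if y == x then eta x :\ u else eta y].
  have tx : theta x = eta x :\ u by rewrite ffunE eqxx.
  have vtx : v \in theta x by rewrite tx in_setD1 vx eq_sym neq_uv.
  have sub y : theta y \subset eta y.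
    by rewrite ffunE; case: eqP => // ->; exact: subsetDl.
  apply/imsetP; exists theta; last first.
    apply/ffunP => y; have [->|nyx] := eqVneq y x; first by rewrite mx // tx setD1K.
    by rewrite my // ffunE (negPf nyx).
  rewrite in_set vtx tx !in_setD1 eqxx andbT in_cells_avoiding.
  move: hA; rewrite in_cells_avoiding => /andP[/hom_cellsP[n0 h] /forall_inP av].
  apply/andP; split; last first.
    by apply/forall_inP => y yA; apply: contra (av y yA); exact: (subsetP (sub y)).
  apply/hom_cellsP; split=> [y|y z eyz a b ay bz].
    have [->|nyx] := eqVneq y x; first by apply/set0Pn; exists v.
    by rewrite ffunE (negPf nyx).
  exact: h eyz _ _ (subsetP (sub y) a ay) (subsetP (sub z) b bz).
have -> : cells_avoiding (x |: A) = cells_avoiding A :\: (S :|: m @: S).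
  rewrite SE; apply/setP => eta; rewrite in_setD [X in ~~ X]in_set.
  rewrite !in_cells_avoiding; case: (eta \in _) => //=.
  apply/forall_inP/andP => [h|[vx /forall_inP h] y /setU1P[->|]]; last exact: h.
    split; last by apply/forall_inP => y yA; apply: h; exact: setU1r.
    by rewrite negb_and h ?setU11 ?orbT.
  by apply: contra vx => vx; rewrite vx andbT; apply/forall_inP.
have homS (eta : {ffun H -> {set G}}) : eta \in S -> forall y, eta y != set0.
  by rewrite in_set in_cells_avoiding => /andP[/andP[/hom_cellsP[]]].
apply: collapses_onto_matching.
- by apply/subsetP => eta; rewrite [eta \in S]in_set => /andP[].
- move=> eta; rewrite [eta \in S]in_set => /and3P[he vx ux]; rewrite in_setD mXS // andbT.
  by rewrite in_set mx // setU11 /= !andbF.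
- move=> eta theta; rewrite !in_set => /and3P[_ vx ux] /and3P[_ vx' ux'] e.
  apply/ffunP => y; have [->|nyx] := eqVneq y x.
    by rewrite -(setU1K ux) -mx // e mx // setU1K.
  by rewrite -my // e my.
- move=> eta etaS; move: (etaS); rewrite in_set => /and3P[_ vx ux]; split.
    apply/hom_faceP => y; have [->|nyx] := eqVneq y x; last by rewrite my.
    by rewrite mx // subsetUr.
  (* Only the summand at [x] changes; it grows by one since [u] is new there and [eta x] is
     nonempty. *)
  rewrite /hom_dim (bigD1 x) //= [in RHS](bigD1 x) //= -addSn mx // cardsU1 ux /=.
  rewrite prednK ?card_gt0 ?homS //; congr (_ + _).
  by apply: eq_bigr => y nyx; rewrite my.
- by move=> eta theta /homS n0 _; exact: hom_dim_lt.
(* A coface of [eta] still has [v] at [x], so it belongs to a matched pair. *)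
- move=> eta theta; rewrite in_set => /and3P[_ vx ux] ht /hom_faceP le.
  by rewrite SE in_set ht (subsetP (le x)).
- move=> eta theta; rewrite !in_set => /and3P[_ vx ux] /and3P[_ vx' _].
  move=> /hom_faceP le; apply/hom_faceP => y; have := le y.
  have [->|nyx] := eqVneq y x; last by rewrite my.
  rewrite mx // => /subsetP sub; apply/subsetP => a ax.
  by have /setU1P[au|//] := sub a ax; rewrite -au ax in ux.
Qed.

Lemma collapse_hom_push :
  collapses_onto (@hom_face H G) (@hom_dim H G)
    (hom_cells H G) (cell_push (del_incl v) H @: hom_cells H (del_vertex v)).
Proof.
rewrite (cell_push_incl_image H neq_uv sub_vu).
(* Induction on a list of vertices, later applied to the enumeration of [H]. *)
have avoid (s : seq H) : collapses_onto (@hom_face H G) (@hom_dim H G)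
    (hom_cells H G) (cells_avoiding [set x in s]).
  elim: s => [|x s IHs].
    suff -> : cells_avoiding [set x in [::]] = hom_cells H G by exact: connect0.
    by apply/setP => eta; rewrite in_set andb_idr // => _; apply/forall_inP => x; rewrite in_set.
  by rewrite set_cons; exact: connect_trans IHs (cells_avoiding_collapse _ x).
have := avoid (enum H); congr (collapses_onto _ _ _ _).
apply/setP => eta; rewrite !in_set; congr (_ && _).
by apply: eq_forallb => x; rewrite in_set mem_enum.
Qed.

End FoldCollapses.

(* Topology of Hom spaces and straight-line homotopies *)
From mathcomp Require Import all_classical all_reals all_analysis.
Import Order.TTheory GRing.Theory Num.Theory.
Import numFieldNormedType.Exports.

Local Open Scope classical_set_scope.
Local Open Scope ring_scope.

(** The pointwise topology is the supremum of the topologies induced by the evaluations. *)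
Lemma continuous_ptws (X : topologicalType) (I : Type) (K : topologicalType)
    (f : X -> {ptws I -> K}) :
  (forall i, continuous (fun x => f x i)) -> continuous f.
Proof.
move=> fi x; apply/cvg_sup => i.
exact: (@continuous_comp_initial _ _ _ (fun g : {ptws I -> K} => g i) f (fi i)).
Qed.

Section HomSpaceContinuity.
Variables (R : realType) (G H : graph).

Lemma continuous_hom_space (X : topologicalType) (f : X -> hom_space R G H) :
  (forall x a, continuous (fun z => val (f z) x a)) -> continuous f.
Proof.
move=> fxa; apply: (@continuous_comp_initial _ _ _ set_val f).
by apply: continuous_ptws => x; apply: continuous_ptws => a; exact: fxa.
Qed.

Lemma continuous_hom_coord (x : G) (a : H) :
  continuous (fun p : hom_space R G H => val p x a).
Proof.
have val_continuous : continuous (val : hom_space R G H -> _).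
  exact: initial_continuous.
move=> p; apply: (@continuous_comp _ _ _ (fun p : hom_space R G H => val p x)
  (fun q : {ptws H -> R} => q a)); last first.
  exact: (@proj_continuous H (fun=> R : topologicalType) a).
apply: (@continuous_comp _ _ _ (val : hom_space R G H -> _)
  (fun q : {ptws G -> {ptws H -> R}} => q x)); first exact: val_continuous.
exact: (@proj_continuous G (fun=> {ptws H -> R} : topologicalType) x).
Qed.

(** Nonnegativity, unit sum and vanishing off [eta x] all survive convex combinations. *)
Lemma closed_cell_convex (eta : {ffun G -> {set H}}) (t : R)
    (p q : {ptws G -> {ptws H -> R}}) :
    0 <= t <= 1 -> closed_cell eta p -> closed_cell eta q ->
  closed_cell eta (fun x a => (1 - t) * p x a + t * q x a).
Proof.
move=> /andP[t0 t1] hp hq x.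
have [p0 p1 ps] := hp x; have [q0 q1 qs] := hq x; split=> [a||a aN].
- by rewrite addr_ge0 ?mulr_ge0 ?subr_ge0.
- by rewrite big_split/= -!mulr_sumr p1 q1 !mulr1 subrK.
- by rewrite ps ?qs// !mulr0 addr0.
Qed.

Lemma homotopic_rel_straight_line (A : set (hom_space R G H))
    (g : hom_space R G H -> hom_space R G H) :
    continuous g -> (forall p, A p -> g p = p) ->
    (forall p, exists2 eta, eta \in hom_cells G H
       & closed_cell eta (val p) /\ closed_cell eta (val (g p))) ->
  homotopic_rel R A g idfun.
Proof.
move=> gc gA gcell.
(* The homotopy must be defined for all real times, while segments are known to stay in a cell only
   for times in [0, 1]; clamping makes it total and globally continuous. *)
pose clamp (t : R) : R := Num.max 0 (Num.min 1 t).
have clamp01 t : 0 <= clamp t <= 1.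
  by rewrite /clamp le_max lexx ge_max ge_min lexx ler01.
have clampE t : 0 <= t <= 1 -> clamp t = t.
  by move=> /andP[t0 t1]; rewrite /clamp (min_idPr t1) (max_idPr t0).
pose line (z : R * hom_space R G H) : {ptws G -> {ptws H -> R}} := fun x a =>
  (1 - clamp z.1) * val (g z.2) x a + clamp z.1 * val z.2 x a.
have line_hom z : line z \in @hom_points R G H.
  apply/mem_set; have [eta etaH [h1 h2]] := gcell z.2.
  by exists eta => //; exact: closed_cell_convex.
pose F z : hom_space R G H := exist _ (line z) (line_hom z).
have FA t p : g p = p -> F (t, p) = p.
  move=> gp; apply: val_inj; apply/funext => x; apply/funext => a /=.
  by rewrite /line /= gp -mulrDl subrK mul1r.
exists F; split.
- apply: continuous_subspaceT; apply: continuous_hom_space => x a.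
  have clampc : continuous (fun z : R * hom_space R G H => clamp z.1).
    move=> z.
    refine (@continuous_max R (R * hom_space R G H)%type (fun=> 0)
      (fun z => Num.min 1 z.1) z _ _).
      exact: cvg_cst.
    apply: (@continuous_min R _ (fun=> 1) fst); first exact: cvg_cst.
    exact: cvg_fst.
  have gxa : continuous (fun z : R * hom_space R G H => val (g z.2) x a).
    move=> z; apply: (@continuous_comp _ _ _ snd (fun p => val (g p) x a)).
      exact: cvg_snd.
    apply: (@continuous_comp _ _ _ g (fun p => val p x a)); first exact: gc.
    exact: continuous_hom_coord.
  have xa : continuous (fun z : R * hom_space R G H => val z.2 x a).
    move=> z; apply: (@continuous_comp _ _ _ snd (fun p : hom_space R G H => val p x a)).
      exact: cvg_snd.
    exact: continuous_hom_coord.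
  move=> z; apply: cvgD; apply: cvgM; [|exact: gxa|exact: clampc|exact: xa].
  by apply: cvgB; [exact: cvg_cst|exact: clampc].
- move=> p; apply: val_inj; apply/funext => x; apply/funext => a /=.
  by rewrite /line /= clampE ?lexx ?ler01// subr0 mul1r mul0r addr0.
- move=> p; apply: val_inj; apply/funext => x; apply/funext => a /=.
  by rewrite /line /= clampE ?lexx ?ler01// subrr mul1r mul0r add0r.
- by move=> t p _ /gA gp; rewrite FA.
Qed.

End HomSpaceContinuity.

(** * Continuity of the induced maps *)

Section InducedMapsContinuity.
Variables (R : realType) (G G' : graph) (phi : graph_hom G G') (H : graph).

Lemma hom_pull_continuous : continuous (hom_pull R phi H).
Proof. by apply: continuous_hom_space => x a; exact: continuous_hom_coord. Qed.

Lemma hom_push_continuous : continuous (hom_push R phi H).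
Proof.
apply: continuous_hom_space => x b; apply: continuous_big => [|a _].
  exact: add_continuous.
exact: continuous_hom_coord.
Qed.

Lemma hom_space_cell (p : hom_space R G H) :
  exists2 eta, eta \in hom_cells G H & closed_cell eta (val p).
Proof. by case: p => p /= /set_mem[eta ? ?]; exists eta. Qed.

Lemma closed_cellS (eta theta : {ffun G -> {set H}}) :
  hom_face eta theta -> @closed_cell R _ _ eta `<=` closed_cell theta.
Proof.
move=> /hom_faceP le p hp x; have [p0 p1 ps] := hp x; split=> // a aN.
by apply: ps; apply: contra aN => /(fintype.subsetP (le x)).
Qed.

End InducedMapsContinuity.

(** * The two deformation retractions *)

Section FoldRetractions.
Variables (R : realType) (G H : graph) (u v : G) (neq_uv : u != v).
Hypothesis sub_vu : neighbors v \subset neighbors u.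
Local Notation i := (del_incl v).
Local Notation f := (fold_hom neq_uv sub_vu).

Lemma hom_pull_incl_retraction :
  strong_deformation_retraction R (hom_pull R f H) (hom_pull R i H).
Proof.
have fK : cancel (hom_pull R f H) (hom_pull R i H).
  move=> p; apply: val_inj; apply/funext => x /=.
  by rewrite /pull_points fold_incl.
split=> //; [exact: hom_pull_continuous|exact: hom_pull_continuous|].
apply: homotopic_rel_straight_line.
- move=> p; apply: (@continuous_comp _ _ _ (hom_pull R i H) (hom_pull R f H));
    exact: hom_pull_continuous.
- by move=> _ [q _ <-] /=; rewrite fK.
move=> p; have [eta etaH ep] := hom_space_cell p.
(* The retraction replaces only the coordinate at [v], by the one at [u], which is supported in
   [eta u]; the joined cell contains both points. *)
exists (cell_join u v eta); first exact: cell_join_hom.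
split.
  apply: closed_cellS ep; apply/hom_faceP => x; rewrite ffunE.
  by case: eqP => // ->; exact: finset.subsetUr.
move=> x; rewrite /= /pull_points /= val_fold_fun.
have [->|nxv] := eqVneq x v; last by rewrite ffunE (negPf nxv); exact: ep.
have [p0 p1 ps] := ep u; split=> // a; rewrite ffunE eqxx finset.in_setU negb_or.
by move=> /andP[/ps].
Qed.

Lemma hom_push_fold_retraction :
  strong_deformation_retraction R (hom_push R i H) (hom_push R f H).
Proof.
have fK : cancel (hom_push R i H) (hom_push R f H).
  move=> p; apply: val_inj; apply/funext => x; apply/funext => b /=.
  rewrite /push_points /affine_ext.
  (* The iterated sum over fibres regroups into one over the fibre of [f \o i], which is [b]
     alone. *)
  transitivity (\sum_(c | f (i c) == b) val p x c).
    rewrite [RHS](partition_big i (fun a => f a == b))//=.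
    apply: eq_bigr => a fab; apply: eq_bigl => c.
    by apply/esym/andb_idl => /eqP ica; move: fab; rewrite -ica.
  by apply: big_pred1 => c; rewrite fold_incl.
split=> //; [exact: hom_push_continuous|exact: hom_push_continuous|].
apply: homotopic_rel_straight_line.
- by move=> p; apply: (@continuous_comp _ _ _ (hom_push R f H) (hom_push R i H));
    exact: hom_push_continuous.
- by move=> _ [q _ <-] /=; rewrite fK.
move=> p; have [eta etaH ep] := hom_space_cell p.
(* The retraction moves weight from [v] to [u] in all coordinates at once, so [u] is allowed
   wherever [v] is. *)
exists (cell_add u v [set: H]%SET eta); first exact: cell_add_hom.
split.
  apply: closed_cellS ep; apply/hom_faceP => x; rewrite ffunE.
  by case: ifP => // _; exact: finset.subsetUr.
have h := push_points_cell i (push_points_cell f ep).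
apply: closed_cellS h; apply/hom_faceP => x; rewrite !ffunE finset.in_setT.
apply/fintype.subsetP => _ /imsetP[_ /imsetP[a ax ->] ->] /=; rewrite val_fold_fun.
have [av|_] := eqVneq a v; first by rewrite -av ax finset.setU11.
by case: ifP => _ //; rewrite finset.in_setU1 ax orbT.
Qed.

End FoldRetractions.

Theorem theorem3p3 (R : realType) (G H : graph) (u v : G) (neq_uv : u != v)
    (sub_vu : neighbors v \subset neighbors u) :
  let i : graph_hom (del_vertex v) G := del_incl v in
  let f : graph_hom G (del_vertex v) := fold_hom neq_uv sub_vu in
  [/\ simplicial_collapses_onto
        (barycentric_subdivision (@hom_face G H) (hom_cells G H))
        (barycentric_subdivision (@hom_face G H)
           (cell_pull f H @: hom_cells (del_vertex v) H)%SET),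
      collapses_onto (@hom_face H G) (@hom_dim H G)
        (hom_cells H G)
        (cell_push i H @: hom_cells H (del_vertex v))%SET,
      strong_deformation_retraction R (hom_pull R f H) (hom_pull R i H)
    & strong_deformation_retraction R (hom_push R i H) (hom_push R f H)].
Proof.
split.
- exact: collapse_hom_pull.
- exact: collapse_hom_push neq_uv sub_vu.
- exact: hom_pull_incl_retraction.
- exact: hom_push_fold_retraction.
Qed.
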